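(* Let $\vec{G}$ be an oriented graph that admits a degree-preserving out-neighbourhood bijective homomorphism $\psi$ to a strongly connected oriented graph $\vec{H}$. Then $|\psi^{-1}(u)|=|\psi^{-1}(v)|$ for all $u,v\in V(\vec{H})$.
   Context: Oriented graphs are finite orientations of simple graphs. An out-neighbourhood bijective homomorphism from $\vec{G}$ to $\vec{H}$ is a map $\psi\colon V(\vec{G})\to V(\vec{H})$ such that for every vertex $v$ the restriction of $\psi$ to $N^+_{\vec{G}}(v)$ is a bijection onto $N^+_{\vec{H}}(\psi(v))$. It is degree-preserving if the (total, underlying undirected) degree of $v$ in $\vec{G}$ equals that of $\psi(v)$ in $\vec{H}$ for every $v$. $\vec{H}$ is strongly connected if there is a directed path between any ordered pair of vertices. *)

(* Defs.v *)
From mathcomp Require Import all_boot.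

Set Implicit Arguments.
Unset Strict Implicit.
Unset Printing Implicit Defensive.

(* [arc u v] means that u -> v is an arc.  By [arc_asym], every edge of the
   underlying simple graph carries exactly one direction. *)
Record oriented_graph := OrientedGraph {
  vertex :> finType;
  arc : rel vertex;
  arc_irrefl : irreflexive arc;
  arc_asym : forall u v : vertex, arc u v -> ~~ arc v u
}.

Arguments arc {o} u v.

Definition out_nbh (G : oriented_graph) (v : G) : {set G} :=
  [set w | arc v w].

Definition underlying (G : oriented_graph) : rel G :=
  fun u v => arc u v || arc v u.

Arguments underlying {G} u v.

Lemma underlying_sym (G : oriented_graph) : symmetric (@underlying G).
Proof. by move=> u v; rewrite /underlying orbC. Qed.

Lemma underlying_irrefl (G : oriented_graph) : irreflexive (@underlying G).
Proof. by move=> u; rewrite /underlying arc_irrefl. Qed.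

Definition degree (G : oriented_graph) (v : G) : nat :=
  #|[set w | underlying v w]|.

Definition out_nbh_bij_hom (G H : oriented_graph) (psi : G -> H) : Prop :=
  forall v : G,
    {in out_nbh v &, injective psi} /\ psi @: out_nbh v = out_nbh (psi v).

Definition degree_preserving (G H : oriented_graph) (psi : G -> H) : Prop :=
  forall v : G, degree v = degree (psi v).

(* [connect] is the reflexive transitive closure, so the path of length 0 from
   a vertex to itself is allowed. *)
Definition strongly_connected (H : oriented_graph) : Prop :=
  forall u v : H, connect arc u v.

(* Main.v *)
Require Import Defs.
From mathcomp Require Import all_boot.
(* [path.arc] would otherwise shadow the [arc] of oriented graphs. *)
Import Defs.

(** Out-degrees and total degrees are preserved, hence so are in-degrees.
    Counting in two ways the arcs of [G] that end in the fibre over [w] then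
    shows that the fibre size at [w] is the average of the fibre sizes over the
    in-neighbours of [w].  By the minimum principle, the set where the fibre
    size is minimal is closed under in-neighbours, so it is everything. *)

(** Asymmetry of [arc] makes out- and in-neighbourhoods disjoint. *)
Lemma degreeE (G : oriented_graph) (v : G) :
  degree v = #|out_nbh v| + #|[set w : G | arc w v]|.
Proof.
rewrite -cardsUI [X in _ + X](_ : _ = 0) ?addn0.
  by rewrite /degree; apply: eq_card => w; rewrite !inE.
apply/eqP; rewrite cards_eq0; apply/eqP/setP=> w; rewrite !inE.
by apply/negP=> /andP[/arc_asym/negP].
Qed.

Lemma in_degree_preserved (G H : oriented_graph) (psi : G -> H) (v : G) :
  out_nbh_bij_hom psi -> degree_preserving psi ->
  #|[set w : G | arc w v]| = #|[set w : H | arc w (psi v)]|.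
Proof.
move=> /(_ v)[inj im] /(_ v); rewrite !degreeE -im card_in_imset //.
exact: addnI.
Qed.

(** Surjectivity yields a preimage of [w] when [arc (psi y) w]; injectivity makes it unique. *)
Lemma card_out_nbh_fibre (G H : oriented_graph) (psi : G -> H) (y : G) (w : H) :
  out_nbh_bij_hom psi ->
  #|[set x in out_nbh y | psi x == w]| = arc (psi y) w.
Proof.
move=> /(_ y)[inj im].
have -> : arc (psi y) w = (w \in psi @: out_nbh y) by rewrite im inE.
case: imsetP => [[x xy ->]|nw].
  apply/eqP/cards1P; exists x; apply/setP=> z; rewrite !inE in xy *.
  apply/andP/eqP=> [[yz /eqP]|->]; last by rewrite eqxx.
  by apply: inj; rewrite inE.
apply/eqP; rewrite cards_eq0; apply/eqP/setP=> z; rewrite inE in_set0.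
by apply/negP=> /andP[yz /eqP wE]; apply: nw; exists z.
Qed.

Lemma fibre_card_average (G H : oriented_graph) (psi : G -> H) (w : H) :
  out_nbh_bij_hom psi -> degree_preserving psi ->
  \sum_(u : H | arc u w) #|psi @^-1: [set u]| =
  #|[set u : H | arc u w]| * #|psi @^-1: [set w]|.
Proof.
move=> hom deg.
(* Grouped by tail: each [y] with [arc (psi y) w] sends exactly one arc into the fibre over [w]. *)
transitivity (\sum_(y : G) \sum_(x | psi x == w) arc y x).
  transitivity (\sum_(y | arc (psi y) w) 1).
    rewrite (partition_big psi (fun u => arc u w)) //=.
    apply: eq_bigr => u uw; rewrite -sum1_card; apply: eq_bigl => y.
    by rewrite !inE; case: eqP => [->|]; rewrite ?uw ?andbF.
  rewrite big_mkcond; apply: eq_bigr => y _.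
  rewrite -[LHS]/(nat_of_bool _) -(card_out_nbh_fibre _ _ _ _ _ hom) -sum1_card.
  rewrite [RHS](eq_bigr (fun x => if arc y x then 1 else 0)); last first.
    by move=> x _; case: arc.
  by rewrite -big_mkcondr; apply: eq_bigl => x; rewrite !inE andbC.
(* Grouped by head: each [x] over [w] contributes its in-degree, which is that of [w]. *)
rewrite exchange_big /= mulnC -sum_nat_const; symmetry.
apply: eq_big => [x|x]; rewrite !inE // => /eqP xw.
rewrite -xw -(in_degree_preserved _ _ _ _ hom deg) -sum1_card big_mkcond.
by apply: eq_bigr => y _; rewrite inE; case: arc.
Qed.

Lemma fibre_card_min (G H : oriented_graph) (psi : G -> H) (u w : H) :
  out_nbh_bij_hom psi -> degree_preserving psi ->
  (forall v : H, #|psi @^-1: [set w]| <= #|psi @^-1: [set v]|) ->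
  arc u w -> #|psi @^-1: [set u]| = #|psi @^-1: [set w]|.
Proof.
move=> hom deg wmin uw.
(* Equality in the summed bound forces equality in every term. *)
have [_ /esym] := leqif_sum (fun v (_ : arc v w) => leqif_eq (wmin v)).
rewrite (fibre_card_average _ _ _ _ hom deg) sum_nat_const -[#|arc^~ w|]cardsE eqxx.
by move=> /forall_inP/(_ u uw)/eqP.
Qed.

Theorem theorem6 (G H : oriented_graph) (psi : G -> H)
  (psi_hom : out_nbh_bij_hom psi) (psi_deg : degree_preserving psi)
  (H_sc : strongly_connected H) (u v : H) :
  #|psi @^-1: [set u]| = #|psi @^-1: [set v]|.
Proof.
case: (arg_minnP (fun x => #|psi @^-1: [set x]|) (isT : xpredT u)) => w _ wmin.
suff eqw x : #|psi @^-1: [set x]| = #|psi @^-1: [set w]| by rewrite !eqw.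
case/connectP: (H_sc x w) => p.
(* Minimality travels backwards along the path, from [w] to [x]. *)
elim: p x => [x _ ->|y p IHp x /= /andP[xy yp] wE] //.
have yw := IHp y yp wE; rewrite -yw.
by apply: fibre_card_min xy => // z; rewrite yw; apply: wmin.
Qed.
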